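(* (a) For every instance of the delegated choice problem (with deterministic biases and no outside option), the corresponding utility configuration instance is $2$-utility aligned. (b) For every instance of the unit-demand pricing problem, the corresponding utility configuration instance is $2$-utility aligned.
   Context: **Utility configuration.** An instance consists of $n$ actions; each action $i$ has a set of possible configurations, and configuration $j$ of action $i$ induces a joint distribution $F_{ij}$ over pairs $(u_i^A,u_i^P)$ of agent and principal utilities, with $u_i^A\in\mathbb{R}\cup\{-\infty\}$ and $u_i^P\ge 0$. A solution (a configuration) is a choice $\mathbf{C}=(C_1,\dots,C_n)$ of one configuration per action. Given $\mathbf{C}$, the pairs $(u_i^A,u_i^P)\sim F_{iC_i}$ are drawn independently across actions $i$, and the agent picks $i^*(\mathbf{C})\in\arg\max_i u_i^A$, ties being broken in favor of the principal. Write $u^A=u^A_{i^*(\mathbf{C})}$ and $u^P=u^P_{i^*(\mathbf{C})}$. The principal's objective is $\mathbb{E}[u^P]$; an optimal configuration maximizes it. **Utility alignment.** For a non-increasing function $f$ on $(0,1]$, an instance is $f(q)$-utility aligned if for every optimal configuration $\mathbf{C}^*$ and every threshold $U$ with $q=\Pr[u^A\le U]>0$ under $\mathbf{C}^*$, one has $\mathbb{E}[u^P\mid u^A\le U]\le f(q)\,\mathbb{E}[u^P]$ under $\mathbf{C}^*$. ''$2$-utility aligned'' means $f\equiv 2$. **Delegated choice.** There are $n$ actions; action $i$ has a deterministic bias $b_i\in\mathbb{R}$ known to the principal and a random value $v_i\ge 0$ with distribution $F_i$, values being independent. The principal selects a nonempty subset $S\subseteq\{1,\dots,n\}$; the agent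 observes the values and chooses the action in $S$ maximizing $v_i+b_i$; the principal receives the value of the chosen action. In the corresponding utility configuration instance each action $i$ has two configurations: ''in'', for which $(u_i^A,u_i^P)=(v_i+b_i,v_i)$ with $v_i\sim F_i$, and ''out'', for which $(u_i^A,u_i^P)=(-\infty,0)$. **Unit-demand pricing.** There are $n$ items; the buyer's values $v_i\sim F_i$ (nonnegative) are independent. The seller sets prices $p_i\ge 0$; the buyer picks the item maximizing $v_i-p_i$, yielding revenue equal to its price, or buys nothing (revenue $0$) if $v_i-p_i<0$ for all $i$. In the corresponding utility configuration instance each price $p_i$ is a configuration of action $i$, with $(u_i^A,u_i^P)=(v_i-p_i,p_i)$ if $v_i-p_i\ge 0$ and $(u_i^A,u_i^P)=(0,0)$ if $v_i-p_i<0$, where $v_i\sim F_i$. *)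

(* Defs.v *)
From HB Require Import structures.
From mathcomp Require Import all_boot all_order all_algebra.
From mathcomp Require Import all_classical all_reals all_analysis.
From mathcomp Require Import measurable_realfun.

Set Implicit Arguments.
Unset Strict Implicit.
Unset Printing Implicit Defensive.

Import Order.TTheory GRing.Theory Num.Theory.
Import numFieldNormedType.Exports.

Local Open Scope classical_set_scope.
Local Open Scope ring_scope.

Section independent_product.
Context d (T : measurableType d) (R : realType).

Definition cons_pair n (x : T * n.-tuple T) : n.+1.-tuple T :=
  [the n.+1.-tuple T of x.1 :: x.2].

Lemma measurable_cons_pair n : measurable_fun setT (@cons_pair n).
Proof.
by apply: measurable_cons; [exact: measurable_fst|exact: measurable_snd].
Qed.

HB.instance Definition _ n :=
  isMeasurableFun.Build _ _ _ _ (@cons_pair n) (@measurable_cons_pair n).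

(* Joint law of independent variables with laws mu i; it is determined by its
   values on rectangles, see product_law_rect. *)
Fixpoint product_law n : ('I_n -> probability T R) -> probability (n.-tuple T) R :=
  match n with
  | 0 => fun=> \d_([tuple] : 0.-tuple T)
  | m.+1 => fun mu => distribution
      (mu ord0 \x product_law (fun i => mu (lift ord0 i)))%E (@cons_pair m)
  end.

Lemma product_law_rect n (mu : 'I_n -> probability T R) (A : 'I_n -> set T) :
  (forall i, measurable (A i)) ->
  product_law mu [set t | forall i, A i (tnth t i)] = (\prod_i mu i (A i))%E.
Proof.
elim: n mu A => [|n ih] mu A mA.
  rewrite big_ord0 /= diracE mem_set//.
  by move=> [].
rewrite big_ord_recl -ih//=.
rewrite /distribution /pushforward -product_measure1E//.
- congr (product_measure1 _ _ _); apply/seteqP; split=> -[x t] /=.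
    move=> h; split; first by have := h ord0; rewrite tnth0.
    by move=> i; have := h (lift ord0 i); rewrite tnthS.
  move=> [hx ht] i; case: (unliftP ord0 i) => [j|] ->; first by rewrite tnthS.
  by rewrite tnth0.
- rewrite [X in measurable X](_ : _ = \bigcap_(i in [set: 'I_n])
      ((fun t : n.-tuple T => tnth t i) @^-1` A (lift ord0 i))).
    apply: fin_bigcap_measurable => // i _; rewrite -[X in measurable X]setTI.
    exact: measurable_tnth.
  by apply/seteqP; split=> t /= h i; [move=> _|]; exact: h.
Qed.

End independent_product.

(* Conditional expectation given an event of positive probability, for a
   nonnegative variable; the value may be +oo. *)
Definition cond_expectation d (T : measurableType d) (R : realType)
    (P : probability T R) (X : T -> R) (A : set T) : \bar R :=
  ((\int[P]_(t in A) (X t)%:E) / P A)%E.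

(* Actions are indexed by 'I_n.+1, so that there is at least one. Utility pairs
   are (agent, principal). *)
Record uc_instance (R : realType) := UCInstance {
  uc_pred_n : nat ;
  uc_config : 'I_uc_pred_n.+1 -> Type ;
  uc_law : forall i, uc_config i -> probability (\bar R * R)%type R ;
  uc_support : forall i (c : uc_config i),
    uc_law c [set u | (u.1 < +oo)%E /\ 0 <= u.2] = 1%E
}.

Section agent.
Context (R : realType) (n : nat).
Implicit Type u : n.+1.-tuple (\bar R * R)%type.

(* Among the maximizers of the agent's utility, one of largest principal
   utility. *)
Definition agent_choice u : 'I_n.+1 :=
  let i0 := [arg max_(i > ord0) (tnth u i).1]%O in
  [arg max_(i > i0 | (tnth u i).1 == (tnth u i0).1) (tnth u i).2]%O.

Definition agent_utility u : \bar R := (tnth u (agent_choice u)).1.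
Definition principal_utility u : R := (tnth u (agent_choice u)).2.

Lemma agent_choice_max u i : ((tnth u i).1 <= agent_utility u)%E.
Proof.
rewrite /agent_utility /agent_choice.
case: (@arg_maxP _ _ 'I_n.+1 ord0 xpredT) => // i0 _ i0max.
by case: arg_maxP => // j /eqP-> _; exact: i0max.
Qed.

Lemma agent_choice_tie u i :
  (tnth u i).1 = agent_utility u -> (tnth u i).2 <= principal_utility u.
Proof.
rewrite /agent_utility /principal_utility /agent_choice.
case: (@arg_maxP _ _ 'I_n.+1 ord0 xpredT) => // i0 _ i0max.
case: arg_maxP => // j /eqP ji0 jmax /eqP; rewrite ji0; exact: jmax.
Qed.

End agent.

Section utility_configuration.
Context (R : realType) (I : uc_instance R).

Definition uc_solution := forall i, uc_config (u := I) i.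

Implicit Type C : uc_solution.

Definition solution_law C := product_law (fun i => uc_law (C i)).

Definition objective C : \bar R := ('E_(solution_law C)[@principal_utility R _])%E.

Definition optimal C := forall C', (objective C' <= objective C)%E.

(* The threshold U ranges over the extended reals because the agent's utility
   may be -oo; +oo is the unconditional case. *)
Definition utility_aligned (f : R -> R) :=
  {in `]0, 1] &, {homo f : x y /~ x <= y}} /\
  forall C, optimal C -> forall U : \bar R,
    let low := [set u | (agent_utility u <= U)%E] in
    (0 < solution_law C low)%E ->
    (cond_expectation (solution_law C) (@principal_utility R _) low
      <= (f (fine (solution_law C low)))%:E * objective C)%E.

End utility_configuration.

Section delegated_choice.
Context (R : realType).

Record delegated_choice := DelegatedChoice {
  dc_pred_n : nat ;
  dc_bias : 'I_dc_pred_n.+1 -> R ;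
  dc_law : 'I_dc_pred_n.+1 -> probability (R) R ;
  dc_law_ge0 : forall i, dc_law i [set v : R | 0 <= v] = 1%E
}.

Definition dc_utilities (b : R) (v : R) : \bar R * R :=
  ((v + b)%:E, v).

Lemma measurable_dc_utilities b : measurable_fun setT (dc_utilities b).
Proof.
apply: measurable_fun_pair => //=; apply/measurable_EFinP.
exact: measurable_funD.
Qed.

HB.instance Definition _ b :=
  isMeasurableFun.Build _ _ _ _ (dc_utilities b) (measurable_dc_utilities b).

(* The solution where every action is out, excluded by the requirement that the
   principal's subset be nonempty, is a solution of this instance; its objective
   is 0, hence it does not affect the optimal value. *)
Variant dc_config := dc_in | dc_out.

Variable D : delegated_choice.

Definition dc_uc_law (i : 'I_(dc_pred_n D).+1) (c : dc_config) :
    probability (\bar R * R)%type R :=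
  match c with
  | dc_in => distribution (dc_law i) (dc_utilities (dc_bias i))
  | dc_out => \d_((-oo%E, 0) : (\bar R * R)%type)
  end.

Lemma dc_uc_support i c :
  dc_uc_law i c [set u | (u.1 < +oo)%E /\ 0 <= u.2] = 1%E.
Proof.
case: c => /=; last by rewrite diracE mem_set.
rewrite -(dc_law_ge0 i) /distribution /pushforward; congr (dc_law i _).
by apply/seteqP; split=> v /= => [[]//|v0]; rewrite ltry.
Qed.

Definition dc_uc_instance : uc_instance R := UCInstance dc_uc_support.

End delegated_choice.

Section unit_demand_pricing.
Context (R : realType).

Record unit_demand_pricing := UnitDemandPricing {
  ud_pred_n : nat ;
  ud_law : 'I_ud_pred_n.+1 -> probability (R) R ;
  ud_law_ge0 : forall i, ud_law i [set v : R | 0 <= v] = 1%E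
}.

Definition ud_utilities (p : R) (v : R) : \bar R * R :=
  if 0 <= v - p then ((v - p)%:E, p) else (0%E, 0).

Lemma measurable_ud_utilities p : measurable_fun setT (ud_utilities p).
Proof.
apply: measurable_fun_ifT => //.
- by apply: measurable_fun_ler => //; exact: measurable_funB.
- apply: measurable_fun_pair => //=; apply/measurable_EFinP.
  exact: measurable_funB.
Qed.

HB.instance Definition _ p :=
  isMeasurableFun.Build _ _ _ _ (ud_utilities p) (measurable_ud_utilities p).

Variable D : unit_demand_pricing.

Definition ud_uc_law (i : 'I_(ud_pred_n D).+1) (p : {p : R | 0 <= p}) :
    probability (\bar R * R)%type R :=
  distribution (ud_law i) (ud_utilities (sval p)).

Lemma ud_uc_support i p :
  ud_uc_law i p [set u | (u.1 < +oo)%E /\ 0 <= u.2] = 1%E.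
Proof.
rewrite /ud_uc_law /distribution /pushforward -(probability_setT (ud_law i)).
congr (ud_law i _); apply/seteqP; split=> v //= _.
by rewrite /ud_utilities; case: ifPn => _ /=; rewrite ltry; split => //; case: p.
Qed.

Definition ud_uc_instance : uc_instance R := UCInstance ud_uc_support.

End unit_demand_pricing.

(* Main.v *)
(* Let V be the optimal objective, assumed finite, and U a threshold. Call an
   action good (predicate L below) if, whenever it gives the agent more than U,
   it gives the principal at least V: biases at most U - V in delegated choice,
   prices at least V in pricing. Let z be the outcome when the other actions are
   dropped, and Z the principal's utility in it.
   - When u^A <= U, the principal gets at most V + Z: if the chosen action is
     good, it is also chosen in z; otherwise it is worth at most V.
   - When some good action gives the agent more than U, Z >= V. As E[Z] <= V,
     this forces E[Z | good actions give at most U] <= V.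
   - Z depends on the good actions only, so by independence conditioning on
     u^A <= U gives the same value E[Z | good actions give at most U].
   Hence E[u^P | u^A <= U] <= 2V. *)
Require Import Defs.
From mathcomp Require Import all_boot all_order all_algebra.
From mathcomp Require Import all_classical all_reals all_analysis.
From mathcomp Require Import measurable_realfun lra.

Set Implicit Arguments.
Unset Strict Implicit.
Unset Printing Implicit Defensive.

Import Order.TTheory GRing.Theory Num.Theory.

Local Open Scope classical_set_scope.
Local Open Scope ring_scope.

(** * Integration and independence under product laws *)

Section product_law_integral.
Context d (T : measurableType d) (R : realType).

Definition rectangle n (A : 'I_n -> set T) : set (n.-tuple T) :=
  [set t | forall i, A i (tnth t i)].

Lemma measurable_rectangle n (A : 'I_n -> set T) :
  (forall i, measurable (A i)) -> measurable (rectangle A).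
Proof.
move=> mA; rewrite [X in measurable X](_ : _ = \bigcap_(i in [set: 'I_n])
    ((fun t : n.-tuple T => tnth t i) @^-1` A i)).
  apply: fin_bigcap_measurable => // i _; rewrite -[X in measurable X]setTI.
  exact: measurable_tnth.
by apply/seteqP; split=> t /= h i; [move=> _|]; exact: h.
Qed.

Lemma ge0_integral_product_lawS n (mu : 'I_n.+1 -> probability T R)
    (f : n.+1.-tuple T -> \bar R) :
  measurable_fun setT f -> (forall t, 0 <= f t)%E ->
  (\int[product_law mu]_t f t =
   \int[mu ord0]_x \int[product_law (fun i => mu (lift ord0 i))]_t
     f (cons_pair (x, t)))%E.
Proof.
move=> mf f0 /=; rewrite /distribution.
rewrite ge0_integral_pushforward//.
rewrite preimage_setT fubini_tonelli1//.
- by apply: measurableT_comp => //; exact: measurable_cons_pair.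
- by move=> x; exact: f0.
Qed.

Lemma measurable_cons_pair1 n (x : T) :
  measurable_fun setT (fun t : n.-tuple T => cons_pair (x, t)).
Proof.
apply: (measurableT_comp (@measurable_cons_pair _ _ _)).
exact: pair1_measurable.
Qed.

(** This is the independence used later: [f] depends only on the coordinates in [L], while the
    rectangle constrains only those outside [L]. Induction on [n] splits off the first coordinate by
    Tonelli and applies the induction hypothesis to the inner integral. *)
Lemma integral_product_law_rectangle n (mu : 'I_n -> probability T R)
    (L : pred 'I_n) (A : 'I_n -> set T) (f : n.-tuple T -> \bar R) :
  (forall i, measurable (A i)) -> (forall i, L i -> A i = setT) ->
  measurable_fun setT f -> (forall t, 0 <= f t)%E ->
  (forall s t, (forall i, L i -> tnth s i = tnth t i) -> f s = f t) ->
  (\int[product_law mu]_(t in rectangle A) f t =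
   product_law mu (rectangle A) * \int[product_law mu]_t f t)%E.
Proof.
elim: n mu L A f => [|n IH] mu L A f mA LA mf f0 fL.
  have -> : rectangle A = setT by apply/seteqP; split => // t _ [].
  by rewrite probability_setT mul1e.
have mR := measurable_rectangle mA.
pose A' i := A (lift ord0 i).
have mA' i : measurable (A' i) by exact: mA.
have mR' := measurable_rectangle mA'.
set P' := product_law (fun i => mu (lift ord0 i)).
have PE : product_law mu (rectangle A) = (mu ord0 (A ord0) * P' (rectangle A'))%E.
  by rewrite !product_law_rect// big_ord_recl.
have mfx x : measurable_fun setT (fun t => f (cons_pair (x, t))).
  by apply: (measurableT_comp mf); exact: measurable_cons_pair1.
have RE x t : (f \_ (rectangle A)) (cons_pair (x, t)) =
    (((fun t => f (cons_pair (x, t))) \_ (rectangle A')) t * (\1_(A ord0) x)%:E)%E.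
  rewrite /patch indicE.
  have -> : (cons_pair (x, t) \in rectangle A) =
            (x \in A ord0) && (t \in rectangle A').
    apply/idP/idP => [/set_mem h|/andP[/set_mem h1 /set_mem h2]].
      apply/andP; split; apply/mem_set; first by have := h ord0; rewrite tnth0.
      by move=> i; have := h (lift ord0 i); rewrite tnthS.
    apply/mem_set => i; case: (unliftP ord0 i) => [j|] ->.
      by rewrite tnthS; exact: h2.
    by rewrite tnth0.
  by case: (x \in A ord0); case: (t \in _) => /=; rewrite ?mule1 ?mule0 ?mul0e.
rewrite integral_mkcond [LHS]ge0_integral_product_lawS; first last.
- by move=> t; exact: erestrict_ge0.
- by apply/(measurable_restrictT _ _).1 => //; exact: measurable_funTS.
rewrite ge0_integral_product_lawS// PE -/P'.
under eq_integral do under eq_integral do rewrite RE.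
have IH' x : (\int[P']_t ((fun t => f (cons_pair (x, t))) \_ (rectangle A')) t =
   P' (rectangle A') * \int[P']_t f (cons_pair (x, t)))%E.
  rewrite -integral_mkcond.
  apply: (IH _ (fun i => L (lift ord0 i))) => //.
  - by move=> i; exact: LA.
  - move=> s t st; apply: fL => i; case: (unliftP ord0 i) => [j|] -> Li.
      by rewrite !tnthS; exact: st.
    by rewrite !tnth0.
have int0 x : (0 <= \int[P']_t f (cons_pair (x, t)))%E by exact: integral_ge0.
have mint : measurable_fun setT (fun x => \int[P']_t f (cons_pair (x, t)))%E.
  apply: (@measurable_fun_fubini_tonelli_F _ _ _ _ _ P' (f \o @cons_pair _ _ _)).
  - by apply: (measurableT_comp mf); exact: measurable_cons_pair.
  - by move=> x; exact: f0.
transitivity (\int[mu ord0]_x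
    (P' (rectangle A') * (\int[P']_t f (cons_pair (x, t)) * (\1_(A ord0) x)%:E)))%E.
  apply: eq_integral => x _; rewrite ge0_integralZr//.
  - by rewrite IH' muleA.
  - by apply/(measurable_restrictT _ _).1 => //; exact: measurable_funTS.
  - by move=> t _; exact: erestrict_ge0.
have mind : measurable_fun setT (fun x => (\1_(A ord0) x)%:E : \bar R).
  exact/measurable_EFinP/measurable_indic.
have ind0 x : (0 <= (\1_(A ord0) x)%:E :> \bar R)%E by rewrite lee_fin.
rewrite ge0_integralZl//; first last.
- by move=> x _; exact: mule_ge0.
- exact: emeasurable_funM.
rewrite [(mu _ _ * _)%E]muleC -muleA; congr (_ * _)%E.
(* Each coordinate matters to one factor only. If the first one is in [L], then [A ord0] is
   everything and has mass 1; otherwise the inner integral is the same for all [x], so the indicator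
   integrates separately. *)
have [L0|/negP L0] := boolP (L ord0).
  have -> : mu ord0 (A ord0) = 1%E by rewrite (LA _ L0); exact: probability_setT.
  rewrite mul1e (LA _ L0); apply: eq_integral => x _.
  by rewrite indicT mule1.
(* [point] is an arbitrary element of [T], at which this constant function of [x] is evaluated. *)
have fE x : (\int[P']_t f (cons_pair (x, t)) =
    \int[P']_t f (cons_pair (point, t)))%E.
  apply: eq_integral => t _; apply: fL => i; case: (unliftP ord0 i) => [j|] -> Li //.
  by rewrite !tnthS.
under eq_integral do rewrite fE.
under [in RHS]eq_integral do rewrite fE.
have c0 := int0 point; set c := (\int[P']_t f (cons_pair (point, t)))%E in c0 *.
rewrite ge0_integralZl// integral_indic// setIT.
rewrite (integral_cst (mu ord0) measurableT c).
rewrite [X in (_ = _ * (_ * X))%E]probability_setT mule1.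
exact: muleC.
Qed.

Lemma measurable_tuple_map d' (T' : measurableType d') n (x : 'I_n -> T -> T') :
  (forall i, measurable_fun setT (x i)) ->
  measurable_fun setT (fun t : n.-tuple T => [tuple x i (tnth t i) | i < n]).
Proof.
move=> mx; apply/measurable_fun_tnthP => i.
rewrite [X in measurable_fun _ X](_ : _ = x i \o (@tnth n T ^~ i)).
  by apply: measurableT_comp => //; exact: measurable_tnth.
by apply/funext => t /=; rewrite tnth_mktuple.
Qed.

End product_law_integral.

(** * Change of variables, coordinate by coordinate *)

Section product_law_distribution.
Context d d' (T : measurableType d) (T' : measurableType d') (R : realType).

(** Images of independent variables are independent: by induction on [n], Tonelli isolates the first
    coordinate, whose law [nu ord0] is the image of [mu ord0]. *)
Lemma ge0_integral_product_law_distribution n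
    (mu : 'I_n -> probability T R) (nu : 'I_n -> probability T' R)
    (x : 'I_n -> T -> T') (f : n.-tuple T' -> \bar R) :
  (forall i, measurable_fun setT (x i)) ->
  (forall i A, measurable A -> nu i A = mu i (x i @^-1` A)) ->
  measurable_fun setT f -> (forall t, 0 <= f t)%E ->
  (\int[product_law nu]_t f t =
   \int[product_law mu]_t f [tuple x i (tnth t i) | i < n])%E.
Proof.
elim: n mu nu x f => [|n IH] mu nu x f mx nuE mf f0.
  rewrite /= !integral_dirac//.
  rewrite !diracT; congr (_ * f _)%E. by rewrite [RHS]tuple0.
  by apply: (measurableT_comp mf); exact: measurable_tuple_map.
rewrite !ge0_integral_product_lawS//; last first.
  by apply: (measurableT_comp mf); exact: measurable_tuple_map.
pose P := product_law (fun i => nu (lift ord0 i)).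
pose g y := (\int[P]_t f (cons_pair (y, t)))%E.
have mg : measurable_fun setT g.
  apply: (@measurable_fun_fubini_tonelli_F _ _ _ _ _ P (f \o @cons_pair _ _ _)).
  - by apply: (measurableT_comp mf); exact: measurable_cons_pair.
  - by move=> y; exact: f0.
transitivity (\int[pushforward (mu ord0) (x ord0)]_y g y)%E.
  apply: eq_measure_integral => /= A mA _; exact: nuE.
rewrite ge0_integral_pushforward//; last first.
  by move=> y _; exact: integral_ge0.
rewrite preimage_setT; apply: eq_integral => y _ /=.
rewrite /g (IH (fun i => mu (lift ord0 i)) _ (fun i => x (lift ord0 i)))//; first last.
- by apply: (measurableT_comp mf); exact: measurable_cons_pair1.
- by move=> i A mA; exact: nuE.
apply: eq_integral => t _; congr f; apply: eq_from_tnth => i.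
rewrite tnth_mktuple; case: (unliftP ord0 i) => [j|] ->.
  by rewrite !tnthS tnth_mktuple.
by rewrite !tnth0.
Qed.

(** The version without sign condition is needed because [principal_utility] can be negative on
    tuples outside the support of the laws. *)
Lemma integral_product_law_distribution n
    (mu : 'I_n -> probability T R) (nu : 'I_n -> probability T' R)
    (x : 'I_n -> T -> T') (f : n.-tuple T' -> \bar R) :
  (forall i, measurable_fun setT (x i)) ->
  (forall i A, measurable A -> nu i A = mu i (x i @^-1` A)) ->
  measurable_fun setT f ->
  (\int[product_law nu]_t f t =
   \int[product_law mu]_t f [tuple x i (tnth t i) | i < n])%E.
Proof.
move=> mx nuE mf; rewrite [LHS]integralE [RHS]integralE; congr (_ - _)%E.
- rewrite (ge0_integral_product_law_distribution mx nuE) //.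
  + by apply: eq_integral => t _; rewrite !funeposE.
  + exact: measurable_funepos.
- rewrite (ge0_integral_product_law_distribution mx nuE) //.
  + by apply: eq_integral => t _; rewrite !funenegE.
  + exact: measurable_funeneg.
Qed.

End product_law_distribution.

(** * The agent's choice: monotonicity and measurability *)

Section agent_properties.
Context (R : realType) (n : nat).
Implicit Types u w : n.+1.-tuple (\bar R * R)%type.

Lemma agent_utility_le u (U : \bar R) :
  (agent_utility u <= U)%E <-> forall i, ((tnth u i).1 <= U)%E.
Proof.
split=> [uU i|]; last by apply.
exact: le_trans (agent_choice_max u i) uU.
Qed.

(** The action chosen in [u] keeps its pair while no action becomes more attractive, so it is still
    a maximizer in [w]. Another choice in [w] must then be a tie, and ties are broken in favor of
    the principal. *)
Lemma principal_utility_mono u w :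
  tnth w (agent_choice u) = tnth u (agent_choice u) ->
  (forall i, (tnth w i).1 <= (tnth u i).1)%E ->
  principal_utility u <= principal_utility w.
Proof.
move=> wu le_wu; rewrite {1}/principal_utility -wu.
apply: agent_choice_tie; apply/eqP; rewrite eq_le agent_choice_max/= wu.
by apply: le_trans (le_wu _) _; exact: agent_choice_max.
Qed.

(** Describes superlevel sets without the nested arg max, as a finite union of finite intersections
    of comparisons; measurability follows from this form. *)
Lemma principal_utility_gt u (r : R) :
  r < principal_utility u <->
  exists i, r < (tnth u i).2 /\ forall j, ((tnth u j).1 <= (tnth u i).1)%E.
Proof.
split=> [ru|[i [ri imax]]].
  by exists (agent_choice u); split => // j; exact: agent_choice_max.
apply: lt_le_trans ri _; apply: agent_choice_tie; apply/eqP.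
by rewrite eq_le agent_choice_max imax.
Qed.

Lemma measurable_principal_utility :
  measurable_fun setT (@principal_utility R n).
Proof.
have m1 i : measurable_fun setT
    (fun u : n.+1.-tuple (\bar R * R)%type => (tnth u i).1).
  by apply: measurableT_comp => //; exact: measurable_tnth.
have m2 i : measurable_fun setT
    (fun u : n.+1.-tuple (\bar R * R)%type => (tnth u i).2).
  by apply: measurableT_comp => //; exact: measurable_tnth.
apply: (measurability (@RGenOInfty.G R)).
  exact: RGenOInfty.measurableE.
move=> _ [_ [r ->] <-]; rewrite setTI.
rewrite [X in measurable X](_ : _ = \bigcup_(i in [set: 'I_n.+1])
  ([set u | r < (tnth u i).2] `&`
   \bigcap_(j in [set: 'I_n.+1]) [set u | (tnth u j).1 <= (tnth u i).1]%E)).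
  apply: fin_bigcup_measurable => // i _; apply: measurableI.
    rewrite -[X in measurable X]setTI.
    have := @measurable_fun_ltr _ _ R setT (cst r) _ (measurable_cst _) (m2 i).
    by move=> /(_ measurableT [set true] Logic.I).
  apply: fin_bigcap_measurable => // j _.
  by rewrite -[X in measurable X]setTI; exact: measurable_lee.
apply/seteqP; split=> u /=.
  rewrite in_itv/= andbT => /principal_utility_gt[i [ri imax]].
  by exists i => //; split=> // j _; exact: imax.
move=> [i _ [ri imax]]; rewrite in_itv/= andbT.
by apply/principal_utility_gt; exists i; split => // j; exact: imax.
Qed.

End agent_properties.

(** * The bound by twice the optimum, on a common space of draws *)

Section coupling.
Context d (T : measurableType d) (R : realType) (n : nat).
Implicit Types (x z : 'I_n.+1 -> T -> \bar R * R).
Implicit Types (mu : 'I_n.+1 -> probability T R).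

Definition outcome x (t : n.+1.-tuple T) : n.+1.-tuple (\bar R * R)%type :=
  [tuple x i (tnth t i) | i < n.+1].

Lemma measurable_principal_utility_outcome x :
  (forall i, measurable_fun setT (x i)) ->
  measurable_fun setT (fun t => principal_utility (outcome x t)).
Proof.
move=> mx; apply: measurableT_comp; first exact: measurable_principal_utility.
exact: measurable_tuple_map.
Qed.

(** The hypotheses collect what both problems supply. [V] stands for the optimal value, [L] for the
    good actions, and [z] for the utilities once the other actions are dropped, which makes their
    pairs constant. On [z] only a bound on the mean is imposed, so it may lie outside the solutions
    of the instance. *)
Lemma integral_low_principal_utility mu x z (L : pred 'I_n.+1) (V : R)
    (U : \bar R) (P := product_law mu)
    (low := [set t | (agent_utility (outcome x t) <= U)%E]) :
  0 <= V ->
  (forall i, measurable_fun setT (x i)) -> (forall i, measurable_fun setT (z i)) ->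
  (forall i, ~~ L i -> forall v w, z i v = z i w) ->
  (forall t, 0 <= principal_utility (outcome x t)) ->
  (forall t, 0 <= principal_utility (outcome z t)) ->
  (\int[P]_t (principal_utility (outcome z t))%:E <= V%:E)%E ->
  (forall t, low t ->
    principal_utility (outcome x t) <= V + principal_utility (outcome z t)) ->
  (forall t i, L i -> (U < (x i (tnth t i)).1)%E ->
    V <= principal_utility (outcome z t)) ->
  (\int[P]_(t in low) (principal_utility (outcome x t))%:E
     <= (2 * V)%:E * P low)%E.
Proof.
move=> V0 mx mz zL x0 z0 intz lowx offz.
pose X t := principal_utility (outcome x t).
pose Z t := principal_utility (outcome z t).
have mX : measurable_fun setT (fun t => (X t)%:E).
  by apply/measurable_EFinP; exact: measurable_principal_utility_outcome.
have mZ : measurable_fun setT (fun t => (Z t)%:E).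
  by apply/measurable_EFinP; exact: measurable_principal_utility_outcome.
have ZL s t : (forall i, L i -> tnth s i = tnth t i) -> Z s = Z t.
  move=> st; congr principal_utility; apply: eq_from_tnth => i.
  rewrite !tnth_mktuple; have [Li|Li] := boolP (L i); first by rewrite st.
  exact: zL.
(* The event [low] is a rectangle. It is cut into [AL], constraining the actions in [L], and [AH],
   constraining the others; these two events are independent. *)
pose A i := [set v | ((x i v).1 <= U)%E].
pose AL i := if L i then A i else setT.
pose AH i := if L i then setT else A i.
have mA i : measurable (A i).
  rewrite -[X in measurable X]setTI; apply: measurable_lee => //.
  exact: (measurableT_comp measurable_fst (mx i)).
have mAL i : measurable (AL i) by rewrite /AL; case: ifP.
have mAH i : measurable (AH i) by rewrite /AH; case: ifP.
have mRL := measurable_rectangle mAL.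
have mRH := measurable_rectangle mAH.
have lowE : low = rectangle A.
  apply/seteqP; split=> t; rewrite /low /= => h.
    by move=> i; have /agent_utility_le/(_ i) := h; rewrite tnth_mktuple.
  by apply/agent_utility_le => i; rewrite tnth_mktuple; exact: h.
have lowI : low = rectangle AH `&` rectangle AL.
  rewrite lowE; apply/seteqP; split=> t.
    by move=> h; split=> i; rewrite /AL /AH; case: ifP => // _; exact: h.
  move=> [hH hL] i; have := hH i; have := hL i; rewrite /AL /AH.
  by case: ifP.
have mlow : measurable low by rewrite lowI; exact: measurableI.
have Plow : (P low = P (rectangle AH) * P (rectangle AL))%E.
  rewrite lowE !product_law_rect// -big_split/=; apply: eq_bigr => i _.
  by rewrite /AL /AH; case: ifP => _; rewrite probability_setT ?mul1e ?mule1.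
(* Like [Z], the restriction to [rectangle AL] is determined by the coordinates in [L], so the
   probability of [rectangle AH] factors out of the integral. *)
pose f := (fun t => (V + Z t)%:E) \_ (rectangle AL).
have mVZ : measurable_fun setT (fun t => (V + Z t)%:E).
  apply/measurable_EFinP/measurable_funD => //; exact/measurable_EFinP.
have f0 t : (0 <= f t)%E.
  by apply: erestrict_ge0 => s _; rewrite lee_fin addr_ge0// z0.
have mf : measurable_fun setT f.
  by apply/(measurable_restrictT _ _).1 => //; exact: measurable_funTS.
have intf : (\int[P]_(t in low) (V + Z t)%:E =
    P (rectangle AH) * \int[P]_t f t)%E.
  rewrite lowI integral_mkcondr; apply: (@integral_product_law_rectangle _ _ _ _ _ L) => //.
    by move=> i Li; rewrite /AH Li.
  move=> s t st; rewrite /f /patch (ZL _ _ st).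
  have -> // : (s \in rectangle AL) = (t \in rectangle AL).
  by apply/idP/idP => /set_mem h; apply/mem_set => i; have := h i;
     rewrite /AL; case: ifP => // Li; rewrite st.
have intZL : (\int[P]_(t in rectangle AL) (Z t)%:E <= V%:E * P (rectangle AL))%E.
  have : (\int[P]_t (Z t)%:E = \int[P]_(t in rectangle AL) (Z t)%:E
      + \int[P]_(t in ~` rectangle AL) (Z t)%:E)%E.
    rewrite -ge0_integral_setU//; [|exact: measurableC|by rewrite setUv|..].
    - by rewrite setUv.
    - by move=> t _; rewrite lee_fin z0.
    - by apply/disj_setPCl.
  have VC : (V%:E * P (~` rectangle AL) <=
      \int[P]_(t in ~` rectangle AL) (Z t)%:E)%E.
    rewrite -(integral_cst P (measurableC mRL)).
    apply: ge0_le_integral => //.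
    - exact: measurableC.
    - exact: measurable_funTS.
    - move=> t /existsNP[i]; rewrite /AL; case: ifP => [Li|_ []//].
      by move=> /negP; rewrite -ltNge lee_fin => /offz; exact.
  move: VC; rewrite probability_setC//.
  have IL0 : (0 <= \int[P]_(t in rectangle AL) (Z t)%:E)%E.
    by apply: integral_ge0 => t _; rewrite lee_fin z0.
  have IH0 : (0 <= \int[P]_(t in ~` rectangle AL) (Z t)%:E)%E.
    by apply: integral_ge0 => t _; rewrite lee_fin z0.
  move=> VC intE; move: intz; rewrite intE => intz.
  (* Let a and b be the integrals of [Z] over [rectangle AL] and its complement, and p the
     probability of [rectangle AL]. From a + b <= V and V(1 - p) <= b follows a <= V p;
     nonnegativity and the bound on the sum exclude infinite values. *)
  move: VC intz IL0 IH0.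
  rewrite -(fineK (fin_num_measure P _ mRL)).
  case: (\int[P]_(t in rectangle AL) _)%E => [a| |]//;
  case: (\int[P]_(t in ~` rectangle AL) _)%E => [b| |]//.
  set p := fine _.
  rewrite (_ : (1 - p%:E)%E = (1 - p)%:E); last by rewrite EFinB.
  by rewrite -!EFinM -EFinD !lee_fin; lra.
apply: (@le_trans _ _ (\int[P]_(t in low) (V + Z t)%:E)%E).
  apply: ge0_le_integral => //.
  - by move=> t _; rewrite lee_fin x0.
  - exact: measurable_funTS.
  - exact: measurable_funTS.
(* After cancelling the factor of [rectangle AH], the terms [V] and [Z] each contribute at most [V]
   times the probability of [rectangle AL]. *)
rewrite intf Plow muleCA lee_pmul//.
- by apply: integral_ge0 => t _; exact: f0.
rewrite -integral_mkcond.
under eq_integral do rewrite EFinD.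
rewrite ge0_integralD//; first last.
- exact: measurable_funTS.
- by move=> t _; rewrite lee_fin z0.
rewrite integral_cst// mulr_natl mulr2n EFinD ge0_muleDl ?lee_fin//.
exact: leeD.
Qed.

End coupling.

(** * Reduction of alignment to a choice of good actions *)

Section alignment.
Context d (T : measurableType d) (R : realType) (I : uc_instance R).
Variable mu : 'I_(uc_pred_n I).+1 -> probability T R.
Implicit Types (C : uc_solution I) (x z : 'I_(uc_pred_n I).+1 -> T -> \bar R * R).

(** The draws from [mu] do not depend on [C], so different solutions can be compared draw by
    draw. *)
Definition induces x C :=
  (forall i, measurable_fun setT (x i)) /\
  (forall i A, measurable A -> uc_law (C i) A = mu i (x i @^-1` A)).

Lemma integral_solution_law x C f : induces x C -> measurable_fun setT f ->
  (\int[solution_law C]_u f u = \int[product_law mu]_t f (outcome x t))%E.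
Proof.
by move=> [mx lawx] mf; exact: integral_product_law_distribution mx lawx mf.
Qed.

Lemma objectiveE x C : induces x C ->
  objective C =
  (\int[product_law mu]_t (principal_utility (outcome x t))%:E)%E.
Proof.
move=> xC; rewrite /objective expectation.unlock; apply: integral_solution_law xC _.
by apply/measurable_EFinP; exact: measurable_principal_utility.
Qed.

Lemma measurable_agent_utility_le n (U : \bar R) :
  measurable [set u : n.+1.-tuple (\bar R * R)%type | (agent_utility u <= U)%E].
Proof.
rewrite [X in measurable X](_ : _ =
    rectangle (fun _ => [set v : \bar R * R | (v.1 <= U)%E])).
  apply: measurable_rectangle => _; rewrite -[X in measurable X]setTI.
  exact: measurable_lee.
by apply/seteqP; split=> u /agent_utility_le.
Qed.

(** Transfers the coupled bound to the law of [C]. The premise on [L] and [z] may assume a finite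
    objective, since an infinite one makes the bound trivial, and a draw in the low event, since
    that event has positive probability; pricing uses this draw to get [0 <= U]. *)
Lemma cond_expectation_low_le x C (U : \bar R)
    (low := [set u | (agent_utility u <= U)%E]) :
  induces x C -> (forall i v, 0 <= (x i v).2) ->
  (forall V, 0 <= V -> objective C = V%:E ->
    (exists t, (agent_utility (outcome x t) <= U)%E) ->
    exists (L : pred 'I_(uc_pred_n I).+1) z,
    [/\ (forall i, measurable_fun setT (z i)) /\ (forall i v, 0 <= (z i v).2),
        forall i, ~~ L i -> forall v w, z i v = z i w,
        (\int[product_law mu]_t (principal_utility (outcome z t))%:E
          <= V%:E)%E,
        forall t, (agent_utility (outcome x t) <= U)%E ->
          principal_utility (outcome x t)
            <= V + principal_utility (outcome z t)
      & forall t i, L i -> (U < (x i (tnth t i)).1)%E ->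
          V <= principal_utility (outcome z t)]) ->
  (0 < solution_law C low)%E ->
  (cond_expectation (solution_law C) (@principal_utility R _) low
    <= 2%:E * objective C)%E.
Proof.
move=> xC x0 hyp q0.
have PU0 y t : (forall i v, 0 <= (y i v).2) ->
    0 <= principal_utility (outcome y t).
  by move=> y0; rewrite /principal_utility tnth_mktuple.
have mlow : measurable low by exact: measurable_agent_utility_le.
have mPU := @measurable_principal_utility R (uc_pred_n I).
pose low' := [set t | (agent_utility (outcome x t) <= U)%E].
have mlow' : measurable low'.
  rewrite [X in measurable X](_ : _ = outcome x @^-1` low) //.
  rewrite -[X in measurable X]setTI; apply: measurable_tuple_map => //.
  by case: xC.
have lowE : solution_law C low = product_law mu low'.
  transitivity (\int[solution_law C]_u (\1_low u)%:E)%E.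
    by rewrite integral_indic// setIT.
  rewrite (integral_solution_law xC); last first.
    by apply/measurable_EFinP; exact: measurable_indic.
  transitivity (\int[product_law mu]_t (\1_low' t)%:E)%E.
    by apply: eq_integral => t _; rewrite !indicE.
  by rewrite integral_indic// setIT.
have intE : (\int[solution_law C]_(u in low) (principal_utility u)%:E =
    \int[product_law mu]_(t in low') (principal_utility (outcome x t))%:E)%E.
  rewrite integral_mkcond (integral_solution_law xC).
    by rewrite [RHS]integral_mkcond.
  apply/(measurable_restrictT _ _).1 => //; apply/measurable_EFinP.
  exact: measurable_funTS.
have obj0 : (0 <= objective C)%E.
  by rewrite (objectiveE xC); apply: integral_ge0 => t _; rewrite lee_fin PU0.
case objE : (objective C) obj0 => [V| |] // V0; last first.
  by rewrite gt0_muley ?leey// lte_fin.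
have nonempty : exists t, (agent_utility (outcome x t) <= U)%E.
  apply: contrapT => /forallNP low0; move: q0; rewrite lowE.
  rewrite (_ : low' = set0) ?measure0 ?ltxx//.
  by apply/seteqP; split.
have [L [z [[mz z0] zL intz lowx offz]]] := hyp V V0 objE nonempty.
have qfin : solution_law C low \is a fin_num by exact: fin_num_measure.
rewrite /cond_expectation -(fineK qfin) -EFinM inver gt_eqF; last first.
  by rewrite fine_gt0// q0 ltey_eq qfin.
rewrite lee_pdivrMr; last by rewrite fine_gt0// q0 ltey_eq qfin.
rewrite fineK// lowE intE.
case: xC => mx _.
by apply: integral_low_principal_utility mx mz zL _ _ intz lowx offz => // t;
  exact: PU0.
Qed.

End alignment.

Lemma probability_setI_full d (T : measurableType d) (R : realType)
    (P : probability T R) (A E : set T) :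
  measurable A -> measurable E -> P E = 1%E -> P (A `&` E) = P A.
Proof.
move=> mA mE PE; have PCE : P (~` E) = 0%E by rewrite probability_setC// PE subee.
rewrite [RHS](measureDI _ mA mE).
rewrite [X in (X + _)%E](_ : _ = 0%E) ?add0e//.
apply/eqP; rewrite eq_le measure_ge0 andbT -PCE; apply: le_measure; rewrite ?inE.
- exact: measurableD.
- exact: measurableC.
- exact: subIsetr.
Qed.

(** * Delegated choice *)

Section delegated_choice_alignment.
Context (R : realType) (D : delegated_choice R).
Implicit Type C : uc_solution (dc_uc_instance D).

(* Truncating the value at 0 leaves the law unchanged and makes the principal's
   utility nonnegative everywhere. *)
Definition dc_coupling C (i : 'I_(dc_pred_n D).+1) (v : R) : \bar R * R :=
  match C i with
  | dc_in => dc_utilities (dc_bias i) (Num.max 0 v)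
  | dc_out => (-oo%E, 0)
  end.

Lemma dc_coupling_ge0 C i v : 0 <= (dc_coupling C i v).2.
Proof. by rewrite /dc_coupling; case: (C i) => //=; rewrite le_max lexx. Qed.

Lemma dc_coupling_induces C :
  induces (I := dc_uc_instance D) (@dc_law R D) (dc_coupling C) C.
Proof.
have mmax b : measurable_fun setT (fun v : R => dc_utilities b (Num.max 0 v)).
  apply: measurableT_comp; first exact: measurable_dc_utilities.
  exact: measurable_maxr.
split=> i; first by rewrite /dc_coupling; case: (C i).
move=> A mA; rewrite /dc_coupling /=; case: (C i) => /=; last first.
  rewrite diracE; have [At|At] := boolP (_ \in A).
    by rewrite (_ : _ @^-1` _ = setT) ?probability_setT//;
      apply/seteqP; split=> // v _; exact: set_mem At.
  rewrite (_ : _ @^-1` _ = set0) ?measure0//.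
  by apply/seteqP; split=> // v /= /mem_set; rewrite (negbTE At).
have mge0 : measurable [set v : R | 0 <= v].
  by rewrite -set_itvcy; exact: measurable_itv.
rewrite /distribution /pushforward.
rewrite -(probability_setI_full _ mge0 (dc_law_ge0 i)); last first.
  by rewrite -[X in measurable X]setTI; exact: measurable_dc_utilities.
rewrite -[RHS](probability_setI_full _ mge0 (dc_law_ge0 i)); last first.
  by rewrite -[X in measurable X]setTI; exact: mmax.
by congr (dc_law i _); apply/seteqP; split=> v /= [Av v0]; split=> //;
  move: Av; rewrite max_r.
Qed.

Lemma dc_aligned : utility_aligned (dc_uc_instance D) (fun=> 2).
Proof.
split=> [//|C optC U low q0].
apply: (cond_expectation_low_le (dc_coupling_induces C)) => //.
  exact: dc_coupling_ge0.
move=> V V0 objV _.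
pose isin (c : dc_config) := if c is dc_in then true else false.
(* The bias condition is written additively because [U] may be infinite. Actions already out are not
   counted as good; they are worth 0 to the principal. *)
pose L (i : 'I_(dc_pred_n D).+1) := isin (C i) && ((dc_bias i + V)%:E <= U)%E.
(* Dropping an action is itself a configuration, so [z] comes from a solution and optimality of [C]
   bounds its mean. *)
pose C' : uc_solution (dc_uc_instance D) := fun i => if L i then C i else dc_out.
have zE i v : dc_coupling C' i v = if L i then dc_coupling C i v else (-oo%E, 0).
  by rewrite /dc_coupling /C'; case: ifP.
exists L, (dc_coupling C'); split.
- split; last exact: dc_coupling_ge0.
  by have [] := dc_coupling_induces C'.
- by move=> i Li v w; rewrite !zE (negbTE Li).
- by rewrite -objV -(objectiveE (dc_coupling_induces C')); exact: optC.
- move=> t /agent_utility_le lowt; set u := outcome _ _; set w := outcome _ _.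
  have w0 : 0 <= principal_utility w.
    by rewrite /principal_utility tnth_mktuple dc_coupling_ge0.
  have [Li|Li] := boolP (L (agent_choice u)).
    apply: ler_wpDl => //; apply: principal_utility_mono => [|i].
      by rewrite !tnth_mktuple zE Li.
    by rewrite !tnth_mktuple zE; case: ifP => //; rewrite leNye.
  apply: ler_wpDr => //; have := lowt (agent_choice u); rewrite -/u.
  move: Li; rewrite /principal_utility !tnth_mktuple /L /dc_coupling.
  case: (C _) => //=; rewrite -ltNge => Ub /le_lt_trans/(_ Ub).
  by rewrite lte_fin addrC ltrD2l => /ltW.
- move=> t i Li Ux; set w := outcome _ _.
  have : (U < agent_utility w)%E.
    by apply: lt_le_trans (agent_choice_max w i); rewrite tnth_mktuple zE Li.
  rewrite /agent_utility /principal_utility !tnth_mktuple zE.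
  (* A dropped action gives the agent -oo, which cannot exceed [U], so the choice is a good
     action. *)
  have [|_] := boolP (L _); last by rewrite ltNge leNye.
  rewrite /L /dc_coupling; case: (C _) => //= bU /(le_lt_trans bU).
  by rewrite lte_fin addrC ltrD2r => /ltW.
Qed.

End delegated_choice_alignment.

(** * Unit-demand pricing *)

Section unit_demand_pricing_alignment.
Context (R : realType) (D : unit_demand_pricing R).
Implicit Type C : uc_solution (ud_uc_instance D).

Definition price C (i : 'I_(ud_pred_n D).+1) : R := sval (C i : {p : R | 0 <= p}).

Definition ud_coupling C i : R -> \bar R * R := ud_utilities (price C i).

Lemma price_ge0 C i : 0 <= price C i.
Proof. exact: svalP (C i : {p : R | 0 <= p}). Qed.

Lemma ud_utilities_ge0 (p v : R) : 0 <= p ->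
  (0 <= (ud_utilities p v).1)%E /\ 0 <= (ud_utilities p v).2.
Proof. by rewrite /ud_utilities => p0; case: ifP; rewrite /= ?lee_fin. Qed.

Lemma ud_coupling_induces C :
  induces (I := ud_uc_instance D) (@ud_law R D) (ud_coupling C) C.
Proof. by split=> i; first exact: measurable_ud_utilities. Qed.

Lemma ud_utilities_gt0 (p v : R) :
  (0 < (ud_utilities p v).1)%E -> (ud_utilities p v).2 = p.
Proof. by rewrite /ud_utilities; case: ifP => //=; rewrite ltxx. Qed.

Lemma ud_utilities_le (p v : R) : 0 <= p -> (ud_utilities p v).2 <= p.
Proof. by rewrite /ud_utilities; case: ifP. Qed.

Lemma ud_aligned : utility_aligned (ud_uc_instance D) (fun=> 2).
Proof.
split=> [//|C optC U low q0].
have u0 C' i v := ud_utilities_ge0 v (price_ge0 C' i).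
apply: (cond_expectation_low_le (ud_coupling_induces C)) => //.
  by move=> i v; have [] := u0 C i v.
move=> V V0 objV [t0 /agent_utility_le/(_ ord0) U0].
(* Agent utilities are nonnegative here, so a nonempty low event forces [0 <= U]. Dropped items,
   which give the agent 0, then never exceed the threshold. *)
have {t0}U0 : (0 <= U)%E.
  by apply: le_trans U0; rewrite tnth_mktuple; have [] := u0 C ord0 (tnth t0 ord0).
pose L i := V <= price C i.
(* A dropped item is represented by the pair of an unsold item. *)
pose z i v := if L i then ud_coupling C i v else (0%E, 0).
have z0 i v : (0 <= (z i v).1)%E /\ 0 <= (z i v).2.
  by rewrite /z; case: ifP => // _; exact: u0.
have zx i v : ((z i v).1 <= (ud_coupling C i v).1)%E.
  by rewrite /z; case: ifP => // _; have [] := u0 C i v.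
have Z0 t : 0 <= principal_utility (outcome z t).
  rewrite /principal_utility tnth_mktuple; set j := agent_choice _.
  by have [] := z0 j (tnth t j).
(* Prices are finite, so an item cannot be excluded outright; pricing it at the
   maximal price M instead earns at least as much as dropping it. *)
pose M := \big[Num.max/0]_i price C i.
have M0 : 0 <= M by exact: bigmax_ge_id.
have CM i : price C i <= M by exact: le_bigmax.
pose C' : uc_solution (ud_uc_instance D) :=
  fun i => if L i then C i else exist _ M M0.
have yE i v : ud_coupling C' i v =
    if L i then ud_coupling C i v else ud_utilities M v.
  by rewrite /ud_coupling /price /C'; case: ifP.
(* Let j be the choice in [z] and k the choice under [C']. If j is dropped, [z] earns 0; if j ties
   with k, tie-breaking suffices. Otherwise k strictly beats j, so k is not good, as j would not be
   chosen in [z]. Then k is priced at [M] and gives the agent a positive utility, hence is sold, for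
   at least the price of j. *)
have zy t : principal_utility (outcome z t) <=
    principal_utility (outcome (ud_coupling C') t).
  set w := outcome _ _; set w' := outcome _ _.
  set j := agent_choice w; set k := agent_choice w'.
  have Zj : principal_utility w = (z j (tnth t j)).2.
    by rewrite /principal_utility tnth_mktuple.
  have Yk : principal_utility w' = (ud_coupling C' k (tnth t k)).2.
    by rewrite /principal_utility tnth_mktuple.
  have Y0 : 0 <= principal_utility w' by rewrite Yk; have [] := u0 C' k (tnth t k).
  rewrite Zj /z; case: ifP => // Lj.
  have := agent_choice_max w' j; rewrite le_eqVlt => /orP[/eqP tie|].
    by have := agent_choice_tie tie; rewrite tnth_mktuple yE Lj.
  rewrite {1}/agent_utility !tnth_mktuple -/k !yE Lj => lt_jk.
  rewrite Yk yE; case: ifP lt_jk => [Lk|Lk] lt_jk.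
    have := agent_choice_max w k; rewrite /agent_utility !tnth_mktuple -/j.
    by rewrite /z Lj Lk leNgt lt_jk.
  rewrite (ud_utilities_gt0 (le_lt_trans _ lt_jk)); last first.
    by have [] := u0 C j (tnth t j).
  by apply: le_trans (CM j); apply: ud_utilities_le; exact: price_ge0.
have mz i : measurable_fun setT (z i).
  by rewrite /z; case: (L i) => //; exact: measurable_ud_utilities.
exists L, z; split.
- by split=> // i v; have [] := z0 i v.
- by move=> i Li v w; rewrite /z (negbTE Li).
- rewrite -objV; apply: le_trans (optC C').
  rewrite (objectiveE (ud_coupling_induces C')); apply: ge0_le_integral => //.
  + by move=> t _; rewrite lee_fin.
  + by apply/measurable_EFinP; exact: measurable_principal_utility_outcome.
  + apply/measurable_EFinP; apply: measurable_principal_utility_outcome => i.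
    exact: measurable_ud_utilities.
  + by move=> t _; rewrite lee_fin.
- move=> t _; set u := outcome _ _; set w := outcome _ _.
  (* A good chosen item survives in [z], where the other utilities can only fall, to 0. An item that
     is not good has price below [V]. *)
  have [Li|Li] := boolP (L (agent_choice u)).
    apply: ler_wpDl => //; apply: principal_utility_mono => [|i].
      by rewrite !tnth_mktuple /z Li.
    by rewrite !tnth_mktuple.
  apply: ler_wpDr; first exact: Z0.
  rewrite /principal_utility tnth_mktuple.
  apply: (@le_trans _ _ (price C (agent_choice u))).
    by apply: ud_utilities_le; exact: price_ge0.
  by apply: ltW; rewrite ltNge.
- move=> t i Li Ux; set w := outcome _ _.
  have : (U < agent_utility w)%E.
    by apply: lt_le_trans (agent_choice_max w i); rewrite tnth_mktuple /z Li.
  rewrite /agent_utility /principal_utility !tnth_mktuple /z.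
  (* The item chosen in [z] gives the agent more than [U], hence more than 0: it is good and sold,
     so it earns its price, at least [V]. *)
  case: ifP => [Lj|_] Uj; last by move: Uj; rewrite /= ltNge U0.
  by rewrite /ud_coupling ud_utilities_gt0//; exact: le_lt_trans Uj.
Qed.

End unit_demand_pricing_alignment.

Theorem lemma3 (R : realType) :
  (forall D : delegated_choice R,
     utility_aligned (dc_uc_instance D) (fun=> 2)) /\
  (forall D : unit_demand_pricing R,
     utility_aligned (ud_uc_instance D) (fun=> 2)).
Proof. by split=> D; [exact: dc_aligned|exact: ud_aligned]. Qed.
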